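(* Let $S=[Y;B_\alpha;\phi_{\alpha,\beta}]$ be a dual weak brace. (a) If $S$ is annihilator nilpotent of nilpotency index $n$, then for every $\alpha\in Y$ the skew brace $B_\alpha$ is annihilator nilpotent of index less than or equal to $n$. (b) Vice versa, if each skew brace $B_\alpha$ ($\alpha\in Y$) is annihilator nilpotent of index $k_\alpha$, then $S$ is annihilator nilpotent of index equal to the maximum of the $k_\alpha$, $\alpha\in Y$.
   Context: A dual weak brace is a triple $(S,+,\circ)$ such that $(S,+)$ is an inverse semigroup, $(S,\circ)$ is a Clifford semigroup (inverse semigroup with central idempotents), and $a\circ(b+c)=a\circ b-a+a\circ c$, $a\circ a^-=-a+a$ for all $a,b,c$, where $-a$, $a^-$ are the inverses of $a$ in $(S,+)$, $(S,\circ)$; then $(S,+)$ is also Clifford and the idempotents of both operations coincide, their set being $\mathrm{E}(S)$. A skew brace is a dual weak brace with exactly one idempotent (both structures are groups). Put $a^0=a-a=a\circ a^-$, $\lambda_a(b)=-a+a\circ b$, $a\cdot b=-a+a\circ b-b$, $[a,b]_+=-a-b+a+b$. Notation $S=[Y;B_\alpha;\phi_{\alpha,\beta}]$: $Y$ is a (lower) semilattice, the $B_\alpha$ ($\alpha\in Y$) are pairwise disjoint skew braces, $\phi_{\alpha,\beta}:B_\alpha\to B_\beta$ ($\alpha\ge\beta$) are skew brace homomorphisms with $\phi_{\alpha,\alpha}=\mathrm{id}$ and $\phi_{\beta,\gamma}\phi_{\alpha,\beta}=\phi_{\alpha,\gamma}$ for $\alpha\ge\beta\ge\gamma$, and $S=\bigcup_\alpha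 B_\alpha$ with $a+b=\phi_{\alpha,\alpha\beta}(a)+\phi_{\beta,\alpha\beta}(b)$, $a\circ b=\phi_{\alpha,\alpha\beta}(a)\circ\phi_{\beta,\alpha\beta}(b)$ for $a\in B_\alpha,b\in B_\beta$; every dual weak brace is of this form. A normal subsemigroup of a Clifford semigroup $T$ is a subset $I$ containing all idempotents of $T$, closed under products and inverses, with $a^{-1}Ia\subseteq I$ for all $a\in T$. An ideal of $S$ is a subset $I$ that is a normal subsemigroup of both $(S,+)$ and $(S,\circ)$ with $\lambda_a(I)\subseteq I$ for all $a\in S$. For an ideal $I$, the relation $a\sim_I b\iff a^0=b^0$ and $-a+b\in I$ is a congruence of $(S,+,\circ)$, and $S/I:=S/{\sim_I}$ is a dual weak brace; if $I\subseteq J$ are ideals, $J/I$ is the image of $J$ in $S/I$. The annihilator is $\mathrm{Ann}(S)=\{a\in S\mid\forall b\in S:\ a+b=b+a=a\circ b=b\circ a\}$, an ideal of $S$. Set $\mathrm{Ann}_0(S)=\mathrm{E}(S)$ and, for $k\ge1$, let $\mathrm{Ann}_k(S)$ be the ideal of $S$ containing $\mathrm{Ann}_{k-1}(S)$ with $\mathrm{Ann}_k(S)/\mathrm{Ann}_{k-1}(S)=\mathrm{Ann}(S/\mathrm{Ann}_{k-1}(S))$. $S$ is annihilator nilpotent if $\mathrm{Ann}_n(S)=S$ for some $n\in\mathbb{N}$. Set $\Gamma_0(S)=S$ and let $\Gamma_k(S)$ be the inverse subsemigroup of $(S,+)$ generated by all $x\cdot s$, $s\cdot x$, $[x,s]_+$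 with $x\in\Gamma_{k-1}(S)$, $s\in S$. The (annihilator) nilpotency index of an annihilator nilpotent $S$ is the smallest non-negative integer $c$ such that $\Gamma_{c+1}(S)=\mathrm{E}(S)$ and $\mathrm{Ann}_c(S)=S$. All these notions apply in particular to skew braces.
   Formalization: In (b) it is assumed that the maximum of the k_α exists (is attained and bounds all k_α); for infinite Y with unbounded k_α there is no maximum and, by (a), S is not annihilator nilpotent, so the claim as worded fails there. *)

(* Defs.v *)
From mathcomp Require Import all_boot all_order generic_quotient.
From mathcomp Require Import boolp classical_sets.

Set Implicit Arguments.
Unset Strict Implicit.
Unset Printing Implicit Defensive.

Local Open Scope classical_set_scope.

Section Semigroups.
Variables (T : Type) (op : T -> T -> T) (inv : T -> T).

Definition idempotents : set T := [set e | op e e = e].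

(* [inv a] is the unique inverse of [a]. *)
Definition inverse_semigroup : Prop :=
  [/\ associative op,
      forall a, op (op a (inv a)) a = a /\ op (op (inv a) a) (inv a) = inv a
    & forall a b, op (op a b) a = a -> op (op b a) b = b -> b = inv a].

Definition clifford_semigroup : Prop :=
  inverse_semigroup /\ forall e, idempotents e -> forall a, op e a = op a e.

Definition inverse_subsemigroup (I : set T) : Prop :=
  (forall a b, I a -> I b -> I (op a b)) /\ (forall a, I a -> I (inv a)).

Definition normal_subsemigroup (I : set T) : Prop :=
  [/\ idempotents `<=` I, inverse_subsemigroup I
    & forall a i, I i -> I (op (op (inv a) i) a)].

End Semigroups.

Section SemigroupTheory.
Variables (T : Type) (op : T -> T -> T) (inv : T -> T).
Local Infix "*" := op.
Local Notation E := (idempotents op).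

Lemma inverse_semigroupI :
  associative op ->
  (forall a, a * inv a * a = a /\ inv a * a * inv a = inv a) ->
  (forall e f, E e -> E f -> e * f = f * e) -> inverse_semigroup op inv.
Proof.
move=> A I C; split=> // a b ab ba; have [ac ca] := I a.
have id1 x y : x * y * x = x -> E (x * y).
  by move=> h; rewrite /idempotents /= A h.
have e1 : a * b = a * inv a.
  have := C _ _ (id1 _ _ ab) (id1 _ _ ac).
  by rewrite A ab A ac.
have e2 : b * a = inv a * a.
  have := C _ _ (id1 _ _ ba) (id1 _ _ ca).
  by rewrite -!A (A a b) ab (A a (inv a)) ac.
by rewrite -ba e2 -A e1 A ca.
Qed.

Hypothesis H : inverse_semigroup op inv.

Lemma isgA : associative op. Proof. by case: H. Qed.
Lemma isgK a : a * inv a * a = a. Proof. by case: H => _ /(_ a)[]. Qed.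
Lemma isgVK a : inv a * a * inv a = inv a. Proof. by case: H => _ /(_ a)[]. Qed.
Lemma isgU a b : a * b * a = a -> b * a * b = b -> b = inv a.
Proof. by case: H => _ _; apply. Qed.
Let A := isgA.

Lemma isgVV a : inv (inv a) = a.
Proof. by rewrite -(@isgU (inv a) a) // (isgK, isgVK). Qed.

Lemma isgE e : E e -> inv e = e.
Proof. by move=> h; rewrite -(@isgU e e) ?h. Qed.

Lemma isgEr a : E (a * inv a).
Proof. by rewrite /idempotents /= A isgK. Qed.
Lemma isgEl a : E (inv a * a).
Proof. by rewrite /idempotents /= A isgVK. Qed.

Lemma isg_mulE e f : E e -> E f -> E (e * f).
Proof.
move=> he hf; set x := inv (e * f).
have := isgK (e * f); have := isgVK (e * f); rewrite -/x -!A => h2 h1.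
have ee y : e * (e * y) = e * y by rewrite A he.
have ff y : f * (f * y) = f * y by rewrite A hf.
have h2' y : x * (e * (f * (x * y))) = x * y.
  by rewrite -[x in RHS]h2 -!A.
have xx : f * (x * e) = x.
  by apply: (@isgU (e * f)); rewrite -!A ?ee ?ff ?h1 ?h2'.
have ex : E x by rewrite /idempotents /= -{1 2}xx -!A h2' xx.
by rewrite -(isgVV (e * f)) -/x isgE.
Qed.

Lemma isg_commE e f : E e -> E f -> e * f = f * e.
Proof.
move=> he hf; have hef := isg_mulE he hf; have hfe := isg_mulE hf he.
have ee y : e * (e * y) = e * y by rewrite A he.
have ff y : f * (f * y) = f * y by rewrite A hf.
rewrite -(isgE hef); symmetry; apply: isgU; rewrite -!A ?ee ?ff.
  by move: hef; rewrite /idempotents /= -!A.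
by move: hfe; rewrite /idempotents /= -!A.
Qed.

Lemma isgVM a b : inv (a * b) = inv b * inv a.
Proof.
have C y : b * (inv b * (inv a * (a * y))) = inv a * (a * (b * (inv b * y))).
  by have := congr1 (op^~ y) (isg_commE (isgEr b) (isgEl a)); rewrite /= -!A.
have C' y : inv a * (a * (b * (inv b * y))) = b * (inv b * (inv a * (a * y))).
  by rewrite C.
have ka y : a * (inv a * (a * y)) = a * y by rewrite !A isgK.
have kb y : inv b * (b * (inv b * y)) = inv b * y by rewrite !A isgVK.
have kb' : b * (inv b * b) = b by rewrite A isgK.
have ka' : inv a * (a * inv a) = inv a by rewrite A isgVK.
symmetry; apply: isgU; rewrite -!A.
  by rewrite C kb' ka.
by rewrite C' kb ka'.
Qed.

Lemma isg_clifford : (forall a, a * inv a = inv a * a) ->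
  clifford_semigroup op inv.
Proof.
move=> c; split=> // e he a.
have ee y : e * (e * y) = e * y by rewrite A he.
have e1 : inv a * (e * a) = e * (a * inv a).
  have := c (e * a); rewrite isgVM (isgE he) -!A ee => <-.
  by rewrite (A a) (isg_commE (isgEr a) he) ee.
have e2 : a * (inv a * (e * a)) = e * a.
  by rewrite 2!A (isg_commE (isgEr a) he) -(A e) isgK.
by rewrite -e2 e1 c (isg_commE he (isgEl a)) !A isgK.
Qed.

End SemigroupTheory.

Section CliffordTheory.
Variables (T : Type) (op : T -> T -> T) (inv : T -> T).
Local Infix "*" := op.
Local Notation E := (idempotents op).
Hypothesis H : clifford_semigroup op inv.
Let I : inverse_semigroup op inv := proj1 H.
Let A := isgA I.

Lemma cliC e a : E e -> e * a = a * e.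
Proof. by move=> he; case: H => _; apply. Qed.

Lemma cliV a : a * inv a = inv a * a.
Proof.
have h : a * inv a = inv a * a * (a * inv a).
  by rewrite [RHS]A (cliC a (isgEl I a)) (A a) (isgK I).
have h' : inv a * a = a * inv a * (inv a * a).
  by rewrite [RHS]A (cliC (inv a) (isgEr I a)) (A (inv a)) (isgVK I).
by rewrite h (isg_commE I (isgEl I a) (isgEr I a)) -h'.
Qed.

Lemma cli0 a b : a * b * inv (a * b) = a * inv a * (b * inv b).
Proof.
rewrite (isgVM I) -A (A b) (cliC _ (isgEr I b)) A; done.
Qed.

End CliffordTheory.

Declare Scope brace_scope.
Delimit Scope brace_scope with B.

Record dual_weak_brace := DualWeakBrace {
  dwb_car :> Type;
  dwb_add : dwb_car -> dwb_car -> dwb_car;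
  dwb_opp : dwb_car -> dwb_car;
  dwb_circ : dwb_car -> dwb_car -> dwb_car;
  dwb_inv : dwb_car -> dwb_car;
  dwb_addP : inverse_semigroup dwb_add dwb_opp;
  dwb_circP : clifford_semigroup dwb_circ dwb_inv;
  dwb_distr : forall a b c, dwb_circ a (dwb_add b c) =
    dwb_add (dwb_add (dwb_circ a b) (dwb_opp a)) (dwb_circ a c);
  dwb_circV : forall a, dwb_circ a (dwb_inv a) = dwb_add (dwb_opp a) a }.

Bind Scope brace_scope with dwb_car.
Notation "a + b" := (dwb_add a b) : brace_scope.
Notation "- a" := (dwb_opp a) : brace_scope.
Notation "a - b" := (dwb_add a (dwb_opp b)) : brace_scope.
Notation "a ∘ b" := (dwb_circ a b) (at level 40, left associativity) : brace_scope.
Local Open Scope brace_scope.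

Section Notions.
Variable S : dual_weak_brace.
Implicit Types (a b x : S) (I : set S).

Definition idem : set S := idempotents (@dwb_add S).
Definition zero a : S := a - a.
Definition lam a b : S := - a + a ∘ b.
Definition dot a b : S := - a + a ∘ b - b.
Definition add_comm a b : S := - a - b + a + b.

Definition is_ideal I : Prop :=
  [/\ normal_subsemigroup (@dwb_add S) (@dwb_opp S) I,
      normal_subsemigroup (@dwb_circ S) (@dwb_inv S) I
    & forall a x, I x -> I (lam a x)].

Definition Ann : set S :=
  [set a | forall b, [/\ a + b = b + a, b + a = a ∘ b & a ∘ b = b ∘ a]].

Fixpoint Gamma (k : nat) : set S :=
  if k is k'.+1 then
    smallest (inverse_subsemigroup (@dwb_add S) (@dwb_opp S))
      [set z | exists2 x, Gamma k' x &
         exists s : S, [\/ z = dot x s, z = dot s x | z = add_comm x s]]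
  else setT.

End Notions.

Arguments idem : clear implicits.
Arguments Ann : clear implicits.
Arguments Gamma : clear implicits.

Record ideal (S : dual_weak_brace) :=
  Ideal { ideal_set :> S -> Prop; idealP : is_ideal ideal_set }.

Definition sim (S : dual_weak_brace) (I : set S) (a b : S) : Prop :=
  zero a = zero b /\ I (- a + b).

Section Theory.
Variable S : dual_weak_brace.
Implicit Types (a b c e f x y : S).
Local Notation E := (idem S).
Let PA := dwb_addP S.
Let CC := dwb_circP S.
Let PC := proj1 CC.

Lemma addA a b c : a + (b + c) = a + b + c. Proof. exact: isgA PA _ _ _. Qed.
Lemma circA a b c : a ∘ (b ∘ c) = a ∘ b ∘ c. Proof. exact: isgA PC _ _ _. Qed.

Lemma idemN e : E e -> - e = e. Proof. exact: isgE PA _. Qed.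

Lemma idem_circE : E = idempotents (@dwb_circ S).
Proof.
apply/seteqP; split=> e he.
  rewrite -he -{1}(idemN he) -dwb_circV; exact: isgEr PC _.
have : E (e ∘ dwb_inv e) by rewrite dwb_circV; exact: isgEl PA _.
by rewrite (isgE PC he) he.
Qed.

Lemma idem_circ e : E e -> e ∘ e = e.
Proof. by rewrite idem_circE. Qed.

Lemma circE e a : E e -> e ∘ a = a ∘ e.
Proof. by rewrite idem_circE ; apply: (cliC CC). Qed.

Lemma addEE e f : E e -> E f -> e + f = f + e.
Proof. by move=> *; apply: (isg_commE PA). Qed.

Lemma E_circ e f : E e -> E f -> E (e ∘ f).
Proof. by rewrite idem_circE => *; apply: (isg_mulE PC). Qed.

Lemma E_add e f : E e -> E f -> E (e + f).
Proof. by move=> *; apply: (isg_mulE PA). Qed.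

Lemma idem_add_circ e f : E e -> E f -> e + f = e ∘ f.
Proof.
have le e' f' : E e' -> E f' -> e' ∘ f' + e' = e' ∘ f'.
  move=> he hf; have := dwb_distr e' f' f'; rewrite hf (idemN he) => h.
  have hg := E_circ he hf; rewrite (addEE hg he) -addA hg in h.
  by rewrite (addEE hg he) -h.
move=> he hf; set g := e + f; have hg : E g := E_add he hf.
have hef := E_circ he hf.
have e1 : e ∘ g = e ∘ f.
  rewrite /g dwb_distr (idemN he) (idem_circ he) he.
  by rewrite (addEE he hef) le.
have e2 : f ∘ g = e ∘ f.
  rewrite /g dwb_distr (idemN hf) (idem_circ hf) -(circE f he).
  by rewrite -addA hf (circE f he) le.
have := dwb_distr g e f.
rewrite -/g (idem_circ hg) (idemN hg) (circE e hg) (circE f hg) e1 e2 => ->.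
rewrite (addEE hef hg) -addA hef /g (addEE (E_add he hf) hef) addA le //.
by rewrite {1}(circE f he) le // circE.
Qed.

Lemma EzeroN a : E (- a + a). Proof. exact: isgEl PA _. Qed.
Lemma Ezero a : E (a - a). Proof. exact: isgEr PA _. Qed.
Lemma NN a : - - a = a. Proof. exact: isgVV PA _. Qed.
Lemma addK a : a - a + a = a. Proof. exact: isgK PA _. Qed.
Lemma circK a : (- a + a) ∘ a = a. Proof. by rewrite -dwb_circV (isgK PC). Qed.

Let zero_le a : a - a = (- a + a) + (a - a).
Proof.
set p := - a + a; set q := a - a.
have hp : E p := EzeroN a; have hq : E q := Ezero a.
have h : a = p + q + a.
  have := dwb_distr p q a.
  rewrite addK circK (idemN hp) -(idem_add_circ hp hq) -[p + q + p]addA.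
  by rewrite (addEE hq hp) addA hp.
by rewrite {1}/q {1}h -addA -/q -addA hq.
Qed.

Lemma zeroE a : a - a = - a + a.
Proof.
have h := zero_le a; have := zero_le (- a); rewrite NN => h'.
by rewrite h (addEE (EzeroN a) (Ezero a)) -h'.
Qed.

Lemma add_clifford : clifford_semigroup (@dwb_add S) (@dwb_opp S).
Proof. exact: isg_clifford PA zeroE. Qed.

Lemma addE e a : E e -> e + a = a + e.
Proof. by move=> he; apply: (cliC add_clifford). Qed.

Lemma E0 a : E (zero a). Proof. exact: Ezero. Qed.
Lemma zeroN a : zero (- a) = zero a.
Proof. by rewrite /zero NN zeroE. Qed.
Lemma zero_circ a : a ∘ dwb_inv a = zero a.
Proof. by rewrite dwb_circV /zero zeroE. Qed.
Lemma zero_circV a : dwb_inv a ∘ a = zero a.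
Proof. by rewrite -zero_circ (cliV CC). Qed.
Lemma add0a a : zero a + a = a. Proof. exact: addK. Qed.
Lemma adda0 a : a + zero a = a. Proof. by rewrite -addE ?add0a //; exact: E0. Qed.
Lemma zeroD a b : zero (a + b) = zero a + zero b.
Proof. exact: (cli0 add_clifford). Qed.
Lemma zeroM a b : zero (a ∘ b) = zero a + zero b.
Proof.
by rewrite -zero_circ (cli0 CC) !zero_circ idem_add_circ //; exact: E0.
Qed.
Lemma zero_id e : E e -> zero e = e.
Proof. by move=> he; rewrite /zero idemN. Qed.
Lemma zeroV a : zero (dwb_inv a) = zero a.
Proof. by rewrite -zero_circ (isgVV PC) zero_circV. Qed.

Lemma circ_idem e a : E e -> e ∘ a = e + a.
Proof.
move=> he.
have hx : e ∘ (e + a) = e + a.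
  have h0 : e + a = (e ∘ zero a) ∘ (e + a).
    rewrite -(idem_add_circ he (E0 a)).
    have -> : e + zero a = zero (e + a) by rewrite zeroD (zero_id he).
    by rewrite -zero_circ (isgK PC).
  by rewrite {1}h0 !circA (idem_circ he) -h0.
rewrite -hx dwb_distr (idem_circ he) (idemN he) he.
have z : zero (e ∘ a) = e + zero (e ∘ a) by rewrite zeroM (zero_id he) addA he.
by rewrite -[in RHS](add0a (e ∘ a)) addA -z add0a.
Qed.

Lemma add_lam a b : a + lam a b = a ∘ b.
Proof.
rewrite /lam addA -/(zero a) -circ_idem; last exact: E0.
by rewrite circA -zero_circ (isgK PC).
Qed.

Lemma circN a b : a ∘ (- b) = a - a ∘ b + a + zero b.
Proof.
have h : a + zero b = a ∘ b - a + a ∘ (- b).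
  by rewrite -dwb_distr -/(zero b) -(circE a (E0 b)) (circ_idem a (E0 b)) -(addE a (E0 b)).
have : - (a ∘ b - a) + (a + zero b) = zero (a ∘ b - a) + a ∘ (- b).
  by rewrite h addA -zeroE.
rewrite (isgVM PA) NN zeroD zeroM zeroN addA => ->.
have -> : zero a + zero b + zero a = zero (a ∘ - b).
  by rewrite zeroM zeroN -addA (addEE (E0 b) (E0 a)) addA [zero a + zero a]E0.
by rewrite add0a.
Qed.

Lemma circ_lam a b : a ∘ lam (dwb_inv a) b = a + b.
Proof.
rewrite {1}/lam dwb_distr circN zero_circ circA zero_circ.
rewrite circ_idem; last exact: E0.
rewrite zeroV (idemN (E0 a)) adda0 -[_ + zero a]addA adda0.
by rewrite -(addA a a) -/(zero a) adda0 addA adda0.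
Qed.
End Theory.

Section Ideals.
Variable S : dual_weak_brace.
Implicit Types (a b c e f x y : S).
Local Notation E := (idem S).
Let PA := dwb_addP S.
Let CC := dwb_circP S.
Let PC := proj1 CC.

Lemma is_idealI (I : set S) :
  E `<=` I -> (forall a b, I a -> I b -> I (a + b)) -> (forall a, I a -> I (- a)) ->
  (forall a i, I i -> I (- a + i + a)) ->
  (forall a b, I a -> I b -> I (a ∘ b)) -> (forall a, I a -> I (dwb_inv a)) ->
  (forall a i, I i -> I (dwb_inv a ∘ i ∘ a)) ->
  (forall a i, I i -> I (lam a i)) -> is_ideal I.
Proof.
by move=> h0 hD hN hJ hM hV hK hl; split=> //; split=> //; rewrite -idem_circE.
Qed.

Lemma idem_ideal : is_ideal E.
Proof.
have J a e : E e -> - a + e + a = e + zero a.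
  by move=> he; rewrite -(addE (- a) he) -addA -zeroE.
have K a e : E e -> dwb_inv a ∘ e ∘ a = e + zero a.
  by move=> he; rewrite -(circE (dwb_inv a) he) -circA zero_circV circ_idem.
apply: is_idealI => //.
- exact: E_add.
- by move=> a ha; rewrite idemN.
- by move=> a e he; rewrite J //; apply: E_add => //; exact: E0.
- exact: E_circ.
- by move=> a ha; rewrite (isgE PC) -?idem_circE.
- by move=> a e he; rewrite K //; apply: E_add => //; exact: E0.
- move=> a e he; rewrite /lam -circE // circ_idem // addA -(addE (- a) he).
  by rewrite -addA -zeroE; apply: E_add => //; exact: E0.
Qed.

Lemma Ann_is_ideal : is_ideal (Ann S).
Proof.
have hE : E `<=` Ann S.
  by move=> e he b; rewrite -(circE b he) (circ_idem b he) (addE b he).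
have hD a b : Ann S a -> Ann S b -> Ann S (a + b).
  move=> ha hb c.
  have hab : a + b = a ∘ b by have [-> ->] := ha b.
  have e1 : a + b + c = c + (a + b).
    by rewrite -addA; have [-> _ _] := hb c; rewrite addA;
       have [-> _ _] := ha c; rewrite addA.
  have e2 : a + b + c = a ∘ b ∘ c.
    have [h1 h2 _] := hb c; have [h3 h4 _] := ha (b ∘ c).
    by rewrite -circA -h4 -h3 -h2 -h1 addA.
  have e3 : a ∘ b ∘ c = c ∘ (a ∘ b).
    by rewrite -circA; have [_ _ ->] := hb c; rewrite circA;
       have [_ _ ->] := ha c; rewrite circA.
  by split; [exact: e1|rewrite -e1 e2 hab|rewrite hab].
have hV a : Ann S a -> dwb_inv a = - a.
  move=> ha; have [h1 h2 _] := ha (dwb_inv a); apply: (isgU PA).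
    by rewrite h1 h2 zero_circ add0a.
  by rewrite h2 zero_circ -zeroV add0a.
have hN a : Ann S a -> Ann S (- a).
  move=> ha c.
  have n1 : - a + c = c - a.
    rewrite -{1}(adda0 (- a)) zeroN -addA (addE c (E0 a)) /zero.
    rewrite (addA c) -(let: And3 h _ _ := ha c in h) !addA -zeroE -/(zero a).
    by rewrite (addE c (E0 a)) -addA -zeroN add0a.
  have n2 : - a + c = dwb_inv a ∘ c.
    have [h1 h2 _] := ha (dwb_inv a ∘ c).
    have h : a + dwb_inv a ∘ c = zero a + c.
      by rewrite h1 h2 circA zero_circ circ_idem //; exact: E0.
    rewrite -{1}(adda0 (- a)) zeroN -addA -h addA -zeroE -/(zero a).
    by rewrite -(circ_idem _ (E0 a)) circA (circ_idem _ (E0 a)) -zeroV add0a.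
  have n3 : c - a = c ∘ dwb_inv a.
    have [h1 h2 _] := ha (c ∘ dwb_inv a).
    have h : c ∘ dwb_inv a + a = c + zero a.
      rewrite h2 circA; have [_ _ ->] := ha c.
      by rewrite -circA zero_circ -(circE c (E0 a)) (circ_idem c (E0 a)) (addE c (E0 a)).
    have : c ∘ dwb_inv a + zero a = c - a.
      by rewrite {1}/zero addA h -addA -zeroN add0a.
    move=> <-; rewrite -(addE _ (E0 a)) -(circ_idem _ (E0 a)) (circE _ (E0 a)).
    by rewrite -circA -(circE _ (E0 a)) (circ_idem _ (E0 a)) -zeroV add0a.
  by rewrite (hV a ha) in n2 n3; split; rewrite // -n2 // -n3 n1.
have z a x : Ann S x -> Ann S (zero a + x).
  by move=> hx; apply: hD => //; apply: hE; exact: E0.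
apply: is_idealI => //.
- move=> a x hx; rewrite -addA; have [-> _ _] := hx a.
  by rewrite addA -zeroE; apply: z.
- by move=> a b ha hb; have [h1 h2 _] := ha b; rewrite -h2 -h1; apply: hD.
- by move=> a ha; rewrite hV //; apply: hN.
- move=> a x hx; rewrite -circA; have [_ _ ->] := hx a.
  by rewrite circA zero_circV circ_idem; [apply: z|exact: E0].
- move=> a x hx; have [_ h2 h3] := hx a; rewrite /lam -h3 -h2 addA -zeroE.
  exact: z.
Qed.
End Ideals.

Section Quotient.
Variables (S : dual_weak_brace) (I : ideal S).
Implicit Types (a b c x y : S).
Let PA := dwb_addP S.
Let PC := proj1 (dwb_circP S).

Lemma ideal_idem e : idem S e -> I e.
Proof. by have [[h _ _] _ _] := idealP I; exact: h. Qed.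
Lemma idealD a b : I a -> I b -> I (a + b).
Proof. by have [[_ [h _] _] _ _] := idealP I; exact: h. Qed.
Lemma idealN a : I a -> I (- a).
Proof. by have [[_ [_ h] _] _ _] := idealP I; exact: h. Qed.
Lemma idealJ a x : I x -> I (- a + x + a).
Proof. by have [[_ _ h] _ _] := idealP I; exact: h. Qed.
Lemma idealM a b : I a -> I b -> I (a ∘ b).
Proof. by have [_ [_ [h _] _] _] := idealP I; exact: h. Qed.
Lemma idealV a : I a -> I (dwb_inv a).
Proof. by have [_ [_ [_ h] _] _] := idealP I; exact: h. Qed.
Lemma idealK a x : I x -> I (dwb_inv a ∘ x ∘ a).
Proof. by have [_ [_ _ h] _] := idealP I; exact: h. Qed.
Lemma ideal_lam a x : I x -> I (lam a x).
Proof. by have [_ _ h] := idealP I; exact: h. Qed.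

Lemma sim_refl a : sim I a a.
Proof. by split=> //; rewrite -zeroE; apply: ideal_idem; exact: E0. Qed.

Lemma sim_sym a b : sim I a b -> sim I b a.
Proof.
by move=> [h hi]; split=> //; rewrite -(NN a) -(isgVM PA); exact: idealN.
Qed.

Lemma sim_trans a b c : sim I a b -> sim I b c -> sim I a c.
Proof.
move=> [h hi] [h' hi']; split; first by rewrite h.
have := idealD hi hi'; rewrite -addA (addA b) -/(zero b) h' add0a; exact.
Qed.

Lemma sim_add a a' b b' : sim I a a' -> sim I b b' -> sim I (a + b) (a' + b').
Proof.
move=> [h hi] [h' hi']; split; first by rewrite !zeroD h h'.
have -> : - (a + b) + (a' + b') = - b + (- a + a') + b + (- b + b').
  by rewrite (isgVM PA) -!addA (addA b) -/(zero b) h' add0a.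
by apply: idealD => //; exact: idealJ.
Qed.

Lemma sim_circ a a' b b' : sim I a a' -> sim I b b' -> sim I (a ∘ b) (a' ∘ b').
Proof.
move=> [h hi] [h' hi']; apply: (@sim_trans _ (a' ∘ b)); split.
- by rewrite !zeroM h.
- have {1}-> : a' = a ∘ lam (dwb_inv a) (- a + a').
    by rewrite circ_lam addA -/(zero a) h add0a.
  set j := lam _ _; have hj : I j by exact: ideal_lam.
  have -> : a ∘ j ∘ b = a ∘ b ∘ (dwb_inv b ∘ j ∘ b).
    rewrite !circA -(circA a b) zero_circ -(circE a (E0 b)) -!circA.
    by rewrite (circE _ (E0 b)) -!circA -(circE b (E0 b)) (circ_idem _ (E0 b)) add0a.
  by apply: ideal_lam; exact: idealK.
- by rewrite !zeroM h'.
- have -> : a' ∘ b' = a' ∘ b + lam a' (- b + b').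
    have {1}-> : b' = b + (- b + b') by rewrite addA -/(zero b) h' add0a.
    by rewrite dwb_distr /lam addA.
  rewrite addA -zeroE; apply: idealD; last exact: ideal_lam.
  by apply: ideal_idem; exact: E0.
Qed.

Lemma sim_opp a b : sim I a b -> sim I (- a) (- b).
Proof.
move=> [h hi]; split; first by rewrite !zeroN.
have -> : - - a - b = - - a - (- a + b) - a.
  by rewrite (isgVM PA) !NN -!addA -/(zero a) h -(zeroN b) adda0.
by apply: idealJ; exact: idealN.
Qed.

Lemma sim_inv a b : sim I a b -> sim I (dwb_inv a) (dwb_inv b).
Proof.
move=> h; have h0 := proj1 h.
have e1 : dwb_inv a = dwb_inv a ∘ b ∘ dwb_inv b.
  rewrite -circA zero_circ -h0 -(circE _ (E0 a)) (circ_idem _ (E0 a)) -zeroV.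
  by rewrite add0a.
have e2 : dwb_inv b = dwb_inv a ∘ a ∘ dwb_inv b.
  by rewrite zero_circV h0 (circ_idem _ (E0 b)) -zeroV add0a.
rewrite e1 {2}e2; apply: sim_circ; last exact: sim_refl.
by apply: sim_circ; [exact: sim_refl|exact: sim_sym].
Qed.

Local Open Scope quotient_scope.

Definition simb : rel {classic S} := fun a b => `[< sim I a b >].
Lemma simb_refl : reflexive simb.
Proof. by move=> a; apply/asboolP; exact: sim_refl. Qed.
Lemma simb_sym : symmetric simb.
Proof. by move=> a b; apply/asboolP/asboolP; exact: sim_sym. Qed.
Lemma simb_trans : transitive simb.
Proof.
by move=> b a c /asboolP h /asboolP h'; apply/asboolP; exact: sim_trans h h'.
Qed.
Definition sim_equiv := EquivRel simb simb_refl simb_sym simb_trans.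

Definition quot_car : Type := {eq_quot sim_equiv}.
Definition quot_pi (a : S) : quot_car := \pi_({eq_quot sim_equiv}) (a : {classic S}).
Definition quot_repr (X : quot_car) : S := repr (X : {eq_quot sim_equiv}).

Lemma quot_reprK X : quot_pi (quot_repr X) = X.
Proof. exact: reprK. Qed.

Lemma quot_piP a b : quot_pi a = quot_pi b <-> sim I a b.
Proof.
split=> [/(@eqmodP _ sim_equiv)/asboolP //|h].
by apply/(@eqmodP _ sim_equiv)/asboolP.
Qed.

Definition quot_add (X Y : quot_car) := quot_pi (quot_repr X + quot_repr Y).
Definition quot_opp (X : quot_car) := quot_pi (- quot_repr X).
Definition quot_circ (X Y : quot_car) := quot_pi (quot_repr X ∘ quot_repr Y).
Definition quot_inv (X : quot_car) := quot_pi (dwb_inv (quot_repr X)).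

Lemma quot_addE a b : quot_add (quot_pi a) (quot_pi b) = quot_pi (a + b).
Proof. by apply/quot_piP/sim_add; apply/quot_piP; exact: quot_reprK. Qed.
Lemma quot_circE a b : quot_circ (quot_pi a) (quot_pi b) = quot_pi (a ∘ b).
Proof. by apply/quot_piP/sim_circ; apply/quot_piP; exact: quot_reprK. Qed.
Lemma quot_oppE a : quot_opp (quot_pi a) = quot_pi (- a).
Proof. by apply/quot_piP/sim_opp; apply/quot_piP; exact: quot_reprK. Qed.
Lemma quot_invE a : quot_inv (quot_pi a) = quot_pi (dwb_inv a).
Proof. by apply/quot_piP/sim_inv; apply/quot_piP; exact: quot_reprK. Qed.

Let quotE := (quot_addE, quot_circE, quot_oppE, quot_invE).

Lemma quot_ind (P : quot_car -> Prop) : (forall a, P (quot_pi a)) -> forall X, P X.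
Proof. by move=> h X; rewrite -(quot_reprK X). Qed.

Lemma quot_add_idem X : quot_add X X = X -> exists2 e, idem S e & X = quot_pi e.
Proof.
elim/quot_ind: X => a; rewrite quotE => h; exists (zero a); first exact: E0.
by rewrite /zero -quot_addE -{2}h quot_addE -addA -/(zero a) adda0.
Qed.

Lemma quot_circ_idem X : quot_circ X X = X -> exists2 e, idem S e & X = quot_pi e.
Proof.
elim/quot_ind: X => a; rewrite quotE => h; exists (zero a); first exact: E0.
rewrite -zero_circ -quot_circE -{2}h quot_circE -circA zero_circ.
by rewrite -(circE a (E0 a)) (circ_idem a (E0 a)) add0a.
Qed.

Lemma quot_addP : inverse_semigroup quot_add quot_opp.
Proof.
apply: inverse_semigroupI.
- elim/quot_ind=> a; elim/quot_ind=> b; elim/quot_ind=> c.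
  by rewrite !quotE addA.
- by elim/quot_ind=> a; rewrite !quotE (isgK PA) (isgVK PA).
- move=> X Y /quot_add_idem[e he ->] /quot_add_idem[f hf ->].
  by rewrite !quotE addEE.
Qed.

Lemma quot_circP : clifford_semigroup quot_circ quot_inv.
Proof.
split; first apply: inverse_semigroupI.
- elim/quot_ind=> a; elim/quot_ind=> b; elim/quot_ind=> c.
  by rewrite !quotE circA.
- by elim/quot_ind=> a; rewrite !quotE (isgK PC) (isgVK PC).
- move=> X Y /quot_circ_idem[e he ->] /quot_circ_idem[f hf ->].
  by rewrite !quotE circE.
- move=> X /quot_circ_idem[e he ->]; elim/quot_ind=> a.
  by rewrite !quotE circE.
Qed.

Lemma quot_distr X Y Z : quot_circ X (quot_add Y Z) =
  quot_add (quot_add (quot_circ X Y) (quot_opp X)) (quot_circ X Z).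
Proof.
elim/quot_ind: X => a; elim/quot_ind: Y => b; elim/quot_ind: Z => c.
by rewrite !quotE dwb_distr.
Qed.

Lemma quot_circV X : quot_circ X (quot_inv X) = quot_add (quot_opp X) X.
Proof. by elim/quot_ind: X => a; rewrite !quotE dwb_circV. Qed.

Definition quotient : dual_weak_brace :=
  DualWeakBrace quot_addP quot_circP quot_distr quot_circV.

Definition quot_map (a : S) : quotient := quot_pi a.

Lemma quot_map_surj (X : quotient) : exists a, quot_map a = X.
Proof. by exists (quot_repr X); exact: quot_reprK. Qed.
Lemma quot_mapP a b : quot_map a = quot_map b <-> sim I a b. Proof. exact: quot_piP. Qed.
Lemma quot_mapD a b : quot_map (a + b) = quot_map a + quot_map b. Proof. by rewrite /= quot_addE. Qed.
Lemma quot_mapM a b : quot_map (a ∘ b) = quot_map a ∘ quot_map b. Proof. by rewrite /= quot_circE. Qed.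
Lemma quot_mapN a : quot_map (- a) = - quot_map a. Proof. by rewrite /= quot_oppE. Qed.
Lemma quot_mapV a : quot_map (dwb_inv a) = dwb_inv (quot_map a).
Proof. by rewrite /= quot_invE. Qed.

Lemma preim_is_ideal (J : ideal quotient) : is_ideal [set a | J (quot_map a)].
Proof.
have [[h0 [hD hN] hJ] [_ [hM hV] hK] hl] := idealP J.
apply: is_idealI => /=.
- by move=> e he; apply: h0; change (quot_map e + quot_map e = quot_map e); rewrite -quot_mapD he.
- by move=> a b ha hb; rewrite quot_mapD; exact: hD.
- by move=> a ha; rewrite quot_mapN; exact: hN.
- by move=> a x hx; rewrite !quot_mapD quot_mapN; exact: hJ.
- by move=> a b ha hb; rewrite quot_mapM; exact: hM.
- by move=> a ha; rewrite quot_mapV; exact: hV.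
- by move=> a x hx; rewrite !quot_mapM quot_mapV; exact: hK.
- by move=> a x hx; rewrite /lam quot_mapD quot_mapN quot_mapM; exact: hl.
Qed.

Lemma sub_preim (J : ideal quotient) : I `<=` [set a | J (quot_map a)].
Proof.
move=> a ha /=; have -> : quot_map a = quot_map (zero a).
  apply/quot_mapP; split; first by rewrite (zero_id (E0 a)).
  by apply: idealD; [exact: idealN|apply: ideal_idem; exact: E0].
have [[h0 _ _] _ _] := idealP J; apply: h0.
by change (quot_map (zero a) + quot_map (zero a) = quot_map (zero a)); rewrite -quot_mapD [_ + _]E0.
Qed.

End Quotient.

(* [Ann_series S k.+1] is the preimage of [Ann (S / Ann_series S k)] under the
   quotient map; by [Ann_seriesP] and [Ann_series_uniq] it is the unique ideal
   containing [Ann_series S k] whose image is that annihilator. *)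
Fixpoint Ann_series (S : dual_weak_brace) (k : nat) : ideal S :=
  if k is k'.+1 then
    let I := Ann_series S k' in
    Ideal (preim_is_ideal (Ideal (Ann_is_ideal (quotient I))))
  else Ideal (idem_ideal S).

Lemma Ann_seriesP (S : dual_weak_brace) (k : nat) :
  Ann_series S k `<=` Ann_series S k.+1 /\
  @quot_map S (Ann_series S k) @` Ann_series S k.+1 = Ann (quotient (Ann_series S k)).
Proof.
split; first exact: sub_preim.
apply/seteqP; split=> [_ [a ha <-] //|X hX].
by have [a e] := quot_map_surj X; exists a => //; rewrite /= e.
Qed.

Lemma Ann_series_uniq (S : dual_weak_brace) (k : nat) (J : ideal S) :
  Ann_series S k `<=` J ->
  @quot_map S (Ann_series S k) @` J = Ann (quotient (Ann_series S k)) ->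
  J = Ann_series S k.+1 :> set S.
Proof.
move=> sub im; apply/seteqP; split=> a ha.
  by rewrite /= -im; exists a.
have : Ann (quotient (Ann_series S k)) (quot_map (Ann_series S k) a) by [].
rewrite -im => -[b hb /quot_mapP[h0 /sub h1]].
by rewrite -(add0a a) -h0 /zero -addA; exact: idealD.
Qed.

Definition ann_nilpotent (S : dual_weak_brace) : Prop :=
  exists n, Ann_series S n = setT :> set S.

Definition is_nilpotency_index (S : dual_weak_brace) (c : nat) : Prop :=
  let P m := Gamma S m.+1 = idem S /\ Ann_series S m = setT :> set S in
  P c /\ forall m, P m -> (c <= m)%N.

Definition ann_nilpotent_of_index (S : dual_weak_brace) (c : nat) : Prop :=
  ann_nilpotent S /\ is_nilpotency_index S c.

Record skew_brace := SkewBrace {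
  sb_dwb :> dual_weak_brace;
  sb_idem : exists! e, idem sb_dwb e }.

(* [phi] is indexed by a proof of [beta <= alpha], i.e. it goes from [B alpha]
   down to [B beta]; the order is boolean, so the proof is irrelevant. *)
Record skew_brace_system d (Y : meetSemilatticeType d) := SkewBraceSystem {
  sys_brace :> Y -> skew_brace;
  sys_map : forall alpha beta : Y, (beta <= alpha)%O ->
    sys_brace alpha -> sys_brace beta;
  sys_mapD : forall alpha beta (h : (beta <= alpha)%O) a b,
    sys_map h (a + b) = sys_map h a + sys_map h b;
  sys_mapM : forall alpha beta (h : (beta <= alpha)%O) a b,
    sys_map h (a ∘ b) = sys_map h a ∘ sys_map h b;
  sys_map_id : forall alpha (h : (alpha <= alpha)%O) a, sys_map h a = a;
  sys_map_comp : forall alpha beta gamma (h : (beta <= alpha)%O)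
      (h' : (gamma <= beta)%O) (h'' : (gamma <= alpha)%O) a,
    sys_map h' (sys_map h a) = sys_map h'' a }.

Section StrongSemilattice.
Import Order.LTheory.
Variables (d : Order.disp_t) (Y : meetSemilatticeType d) (F : skew_brace_system Y).

Definition ss_car : Type := {alpha : Y & F alpha}.
Implicit Types x y z : ss_car.

Definition ss_down x (beta : Y) (h : (beta <= tag x)%O) : F beta :=
  sys_map h (tagged x).
Arguments ss_down x {beta} h.

Definition ss_add x y : ss_car :=
  Tagged (fun alpha => F alpha)
    (ss_down x (leIl (tag x) (tag y)) + ss_down y (leIr (tag y) (tag x))).
Definition ss_circ x y : ss_car :=
  Tagged (fun alpha => F alpha)
    (ss_down x (leIl (tag x) (tag y)) ∘ ss_down y (leIr (tag y) (tag x))).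
Definition ss_opp x : ss_car := Tagged (fun alpha => F alpha) (- tagged x).
Definition ss_inv x : ss_car := Tagged (fun alpha => F alpha) (dwb_inv (tagged x)).


Lemma sys_mapN alpha beta (h : (beta <= alpha)%O) (a : F alpha) :
  sys_map h (- a) = - sys_map h a.
Proof.
have PA b := dwb_addP (F b).
by apply: (isgU (PA _)); rewrite -!sys_mapD ?(isgK (PA _)) ?(isgVK (PA _)).
Qed.

Lemma sys_mapV alpha beta (h : (beta <= alpha)%O) (a : F alpha) :
  sys_map h (dwb_inv a) = dwb_inv (sys_map h a).
Proof.
have PC b := proj1 (dwb_circP (F b)).
by apply: (isgU (PC _)); rewrite -!sys_mapM ?(isgK (PC _)) ?(isgVK (PC _)).
Qed.

Lemma ss_eq x y : tag x = tag y ->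
  (forall delta h h', @ss_down x delta h = @ss_down y delta h') -> x = y.
Proof.
case: x y => [alpha a] [beta b] /= e; case: beta / e b => b H.
have := H alpha (lexx _) (lexx _).
by rewrite /ss_down /= !sys_map_id => ->.
Qed.

Lemma ss_down_eq x y (delta : Y) h h' : x = y -> @ss_down x delta h = @ss_down y delta h'.
Proof. by move=> e; case: y / e h' => h'; rewrite (bool_irrelevance h h'). Qed.

Lemma ss_downD x y delta h (hx : (delta <= tag x)%O) (hy : (delta <= tag y)%O) :
  @ss_down (ss_add x y) delta h = ss_down x hx + ss_down y hy.
Proof. by rewrite /ss_down /= sys_mapD; congr (_ + _); exact: sys_map_comp. Qed.

Lemma ss_downM x y delta h (hx : (delta <= tag x)%O) (hy : (delta <= tag y)%O) :
  @ss_down (ss_circ x y) delta h = ss_down x hx ∘ ss_down y hy.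
Proof. by rewrite /ss_down /= sys_mapM; congr (_ ∘ _); exact: sys_map_comp. Qed.

Lemma ss_downN x delta (h : (delta <= tag x)%O) : @ss_down (ss_opp x) delta h = - ss_down x h.
Proof. by rewrite /ss_down /= sys_mapN. Qed.

Lemma ss_downV x delta (h : (delta <= tag x)%O) :
  @ss_down (ss_inv x) delta h = dwb_inv (ss_down x h).
Proof. by rewrite /ss_down /= sys_mapV. Qed.

Lemma ss_idemD x delta (h : (delta <= tag x)%O) :
  idempotents ss_add x -> idem (F delta) (ss_down x h).
Proof.
move=> e; have h2 : (delta <= tag (ss_add x x))%O by rewrite /= lexI h.
by rewrite /idem /idempotents /= -(ss_downD h2 h h); exact: ss_down_eq.
Qed.

Lemma ss_idemM x delta (h : (delta <= tag x)%O) :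
  idempotents ss_circ x -> idem (F delta) (ss_down x h).
Proof.
move=> e; have h2 : (delta <= tag (ss_circ x x))%O by rewrite /= lexI h.
by rewrite idem_circE /idempotents /= -(ss_downM h2 h h); exact: ss_down_eq.
Qed.

Lemma ss_addP : inverse_semigroup ss_add ss_opp.
Proof.
have PA b := dwb_addP (F b).
apply: inverse_semigroupI => [x y z|x|x y hx hy].
- apply: ss_eq => [|delta h h']; first exact: meetA.
  have: (delta <= tag x `&` (tag y `&` tag z))%O by [].
  rewrite !lexI => /and3P[hx hy hz].
  have hxy : (delta <= tag (ss_add x y))%O by rewrite /= lexI hx.
  have hyz : (delta <= tag (ss_add y z))%O by rewrite /= lexI hy.
  rewrite (ss_downD h hx hyz) (ss_downD hyz hy hz) (ss_downD h' hxy hz).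
  by rewrite (ss_downD hxy hx hy) addA.
- have K u v : tag u = tag x -> tag v = tag x -> tag (ss_add (ss_add u v) u) = tag x.
    by move=> /= -> ->; rewrite !meetxx.
  split; apply: ss_eq => [|delta h h']; rewrite ?K //.
    have h2 : (delta <= tag (ss_add x (ss_opp x)))%O by rewrite /= lexI h'.
    rewrite (ss_downD h h2 h') (ss_downD h2 h' (h' : (delta <= tag (ss_opp x))%O)).
    by rewrite ss_downN (isgK (PA _)).
  have h2 : (delta <= tag (ss_add (ss_opp x) x))%O by rewrite /= lexI h'.
  rewrite (ss_downD h h2 h') (ss_downD h2 h' (h' : (delta <= tag x)%O)).
  by rewrite !(@ss_downN x) (isgVK (PA _)).
- apply: ss_eq => [|delta h h']; first exact: meetC.
  have: (delta <= tag x `&` tag y)%O by [].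
  rewrite !lexI => /andP[h1 h2].
  by rewrite (ss_downD h h1 h2) (ss_downD h' h2 h1) addEE //; exact: ss_idemD.
Qed.

Lemma ss_circP : clifford_semigroup ss_circ ss_inv.
Proof.
have PC b := proj1 (dwb_circP (F b)).
have cen x y : idempotents ss_circ x -> ss_circ x y = ss_circ y x.
  move=> hx; apply: ss_eq => [|delta h h']; first exact: meetC.
  have: (delta <= tag x `&` tag y)%O by [].
  rewrite !lexI => /andP[h1 h2].
  by rewrite (ss_downM h h1 h2) (ss_downM h' h2 h1) circE //; exact: ss_idemM.
split; last by move=> e he a; exact: cen.
apply: inverse_semigroupI => [x y z|x|x y hx hy]; last exact: cen.
- apply: ss_eq => [|delta h h']; first exact: meetA.
  have: (delta <= tag x `&` (tag y `&` tag z))%O by [].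
  rewrite !lexI => /and3P[hx hy hz].
  have hxy : (delta <= tag (ss_circ x y))%O by rewrite /= lexI hx.
  have hyz : (delta <= tag (ss_circ y z))%O by rewrite /= lexI hy.
  rewrite (ss_downM h hx hyz) (ss_downM hyz hy hz) (ss_downM h' hxy hz).
  by rewrite (ss_downM hxy hx hy) circA.
- have K u v : tag u = tag x -> tag v = tag x -> tag (ss_circ (ss_circ u v) u) = tag x.
    by move=> /= -> ->; rewrite !meetxx.
  split; apply: ss_eq => [|delta h h']; rewrite ?K //.
    have h2 : (delta <= tag (ss_circ x (ss_inv x)))%O by rewrite /= lexI h'.
    rewrite (ss_downM h h2 h') (ss_downM h2 h' (h' : (delta <= tag (ss_inv x))%O)).
    by rewrite ss_downV (isgK (PC _)).
  have h2 : (delta <= tag (ss_circ (ss_inv x) x))%O by rewrite /= lexI h'.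
  rewrite (ss_downM h h2 h') (ss_downM h2 h' (h' : (delta <= tag x)%O)).
  by rewrite !(@ss_downV x) (isgVK (PC _)).
Qed.

Lemma ss_distr x y z : ss_circ x (ss_add y z) =
  ss_add (ss_add (ss_circ x y) (ss_opp x)) (ss_circ x z).
Proof.
apply: ss_eq => [|delta h h'].
  by rewrite /= (meetAC (tag x) (tag y) (tag x)) meetxx meetACA meetxx.
have: (delta <= tag x `&` (tag y `&` tag z))%O by [].
rewrite !lexI => /and3P[hx hy hz].
have hyz : (delta <= tag (ss_add y z))%O by rewrite /= lexI hy.
have hxy : (delta <= tag (ss_circ x y))%O by rewrite /= lexI hx.
have hxz : (delta <= tag (ss_circ x z))%O by rewrite /= lexI hx.
have h1 : (delta <= tag (ss_add (ss_circ x y) (ss_opp x)))%O.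
  by rewrite /= !lexI hx hy.
rewrite (ss_downM h hx hyz) (ss_downD hyz hy hz) (ss_downD h' h1 hxz).
rewrite (ss_downD h1 hxy (hx : (delta <= tag (ss_opp x))%O)) ss_downN.
by rewrite (ss_downM hxy hx hy) (ss_downM hxz hx hz) dwb_distr.
Qed.

Lemma ss_circV x : ss_circ x (ss_inv x) = ss_add (ss_opp x) x.
Proof.
apply: ss_eq => // delta h h'.
have: (delta <= tag x `&` tag x)%O by [].
rewrite lexI => /andP[hx _].
rewrite (ss_downM h hx (hx : (delta <= tag (ss_inv x))%O)) ss_downV.
by rewrite (ss_downD h' (hx : (delta <= tag (ss_opp x))%O) hx) ss_downN dwb_circV.
Qed.

Definition strong_semilattice : dual_weak_brace :=
  DualWeakBrace ss_addP ss_circP ss_distr ss_circV.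

End StrongSemilattice.

(* Main.v *)
(** Both conditions in the definition of the index reduce to [Ann_c(S) = S],
    since [Gamma_k(S)] lies in [Ann_(c-k)(S)] as soon as [Ann_c(S) = S]. By
    induction on [k], an element [a] of [B_alpha] lies in [Ann_k(S)] iff
    [phi_(alpha,beta)(a)] lies in [Ann_k(B_beta)] for all [beta <= alpha]; hence
    [Ann_k(S) = S] iff [Ann_k(B_alpha) = B_alpha] for all [alpha]. *)
From mathcomp Require Import all_boot all_order.
From mathcomp Require Import boolp classical_sets.
Require Import Defs.

Set Implicit Arguments.
Unset Strict Implicit.
Unset Printing Implicit Defensive.

Local Open Scope classical_set_scope.
Local Open Scope brace_scope.

Section AnnSeries.
Variable S : dual_weak_brace.
Implicit Types (a b x s : S).

(** Since [quot_map] is a surjective homomorphism, the annihilator of the quotient can be tested on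
    representatives; later arguments use only [sim] and never meet quotients again. *)
Lemma Ann_seriesS k a : Ann_series S k.+1 a <->
  forall b, [/\ sim (Ann_series S k) (a + b) (b + a),
                sim (Ann_series S k) (b + a) (a ∘ b)
              & sim (Ann_series S k) (a ∘ b) (b ∘ a)].
Proof.
set I := Ann_series S k.
have -> : Ann_series S k.+1 a = Ann (quotient I) (quot_map I a) by [].
split=> [h b|h X].
  have [h1 h2 h3] := h (quot_map I b).
  by split; apply/quot_mapP; rewrite ?quot_mapD ?quot_mapM.
have [b <-] := quot_map_surj X; have [h1 h2 h3] := h b.
by split; rewrite -?quot_mapD -?quot_mapM; apply/quot_mapP.
Qed.

Lemma Ann_series_leq m n : (m <= n)%N -> Ann_series S m `<=` Ann_series S n.
Proof.
move=> /subnK <-; elim: (n - m)%N => [|i IH] a ha //.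
exact: (proj1 (Ann_seriesP S (i + m))) (IH _ ha).
Qed.

Lemma Ann_series_setT_leq m n : (m <= n)%N ->
  Ann_series S m = setT :> set S -> Ann_series S n = setT :> set S.
Proof.
move=> le h; apply/seteqP; split=> // a _.
by apply: (Ann_series_leq le); rewrite h.
Qed.

(** Conjugating [- (a + b) + a ∘ b] by [- b] gives [zero b + dot a b]; the idempotent [zero b] is
    central and is absorbed by the final [- b] of [dot a b]. *)
Lemma sim_dot (I : ideal S) a b : sim I (a + b) (a ∘ b) -> I (dot a b).
Proof.
move=> [_ h]; have := idealJ (- b) h.
rewrite NN (isgVM (dwb_addP S)) !addA -/(zero b) (addE (- a) (E0 b)).
rewrite -(addA (- a)) (addE (a ∘ b) (E0 b)) addA -(addA _ (zero b)).
by rewrite -(zeroN b) add0a.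
Qed.

Lemma Ann_seriesS_dot k x s : Ann_series S k.+1 x ->
  [/\ Ann_series S k (dot x s), Ann_series S k (dot s x)
    & Ann_series S k (add_comm x s)].
Proof.
move=> /Ann_seriesS /(_ s)[h1 h2 h3]; split.
- by apply: sim_dot; apply: sim_trans h1 h2.
- by apply: sim_dot; apply: sim_trans h2 h3.
- have [_] := sim_sym h1.
  by rewrite (isgVM (dwb_addP S)) !addA.
Qed.

(** An idempotent satisfies [e = dot e e], so it is a generator at every stage. *)
Lemma idem_Gamma k : idem S `<=` Gamma S k.
Proof.
elim: k => [|k IH] e he //=; apply: sub_gen_smallest.
exists e; first exact: IH; exists e; apply: Or31.
by rewrite /dot (idem_circ he) (idemN he) !he.
Qed.

(** Induction on [k] with [n] free: one unit moves from [k] to [n], and the generators built from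
    [Ann_series S n.+1] fall into [Ann_series S n]. *)
Lemma Gamma_Ann_series n k : Ann_series S (n + k) = setT :> set S ->
  Gamma S k `<=` Ann_series S n.
Proof.
elim: k n => [|k IH] n h; first by rewrite addn0 in h; rewrite h.
rewrite addnS -addSn in h; apply: smallest_sub.
  split=> [a b|a]; [exact: idealD|exact: idealN].
by move=> z [x /(IH _ h) /Ann_seriesS_dot hx [s [] ->]]; have [] := hx s.
Qed.

Lemma Gamma_idem n : Ann_series S n = setT :> set S -> Gamma S n.+1 = idem S.
Proof.
move=> h; apply/seteqP; split; last exact: idem_Gamma.
(* [Ann_series S 0] is [idem S]; the hypothesis needed at [0 + n.+1] follows from the one at [n] by
   monotonicity. *)
by apply: (@Gamma_Ann_series 0); apply: Ann_series_setT_leq h.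
Qed.

Lemma ann_nilpotent_of_indexE c : ann_nilpotent_of_index S c <->
  Ann_series S c = setT :> set S /\
  forall m, Ann_series S m = setT :> set S -> (c <= m)%N.
Proof.
split=> [[_ [[_ hc] hm]]|[hc hm]].
  by split=> // m h; apply: hm; split=> //; exact: Gamma_idem.
split; first by exists c.
split; first by split=> //; exact: Gamma_idem.
by move=> m [_]; exact: hm.
Qed.

Lemma ann_nilpotent_index n : Ann_series S n = setT :> set S ->
  exists m, (m <= n)%N /\ ann_nilpotent_of_index S m.
Proof.
move=> h.
have ex : exists i, `[< Ann_series S i = setT :> set S >].
  by exists n; apply/asboolP.
case: (ex_minnP ex) => m /asboolP hm min.
have le i : Ann_series S i = setT :> set S -> (m <= i)%N.
  by move=> hi; apply: min; apply/asboolP.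
by exists m; split; [exact: le|apply/ann_nilpotent_of_indexE].
Qed.

End AnnSeries.

(** Makes the first clause of [sim] automatic in each component. *)
Lemma skew_brace_zero (B : skew_brace) (a b : B) : zero a = zero b.
Proof. by have [e [_ u]] := sb_idem B; rewrite -(u _ (E0 a)); apply: u; exact: E0. Qed.

Section StrongSemilatticeAnn.
Import Order.LTheory.
Variables (d : Order.disp_t) (Y : meetSemilatticeType d).
Variable F : skew_brace_system Y.
Local Notation SS := (strong_semilattice F).

(** Each component has a single idempotent, so [zero x] records exactly the component of [x]. *)
Lemma ss_zero_eq (x y : SS) : zero x = zero y <-> tag x = tag y.
Proof.
split=> [h|h].
  by have := congr1 tag h; rewrite /= !meetxx.
apply: ss_eq => [|delta h1 h2]; first by rewrite /= !meetxx.
have hx : (delta <= tag x)%O by move: h1; rewrite /= meetxx.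
have hy : (delta <= tag y)%O by move: h2; rewrite /= meetxx.
rewrite (ss_downD h1 hx hx) (ss_downD h2 hy hy) !ss_downN.
exact: skew_brace_zero.
Qed.

Lemma ss_idemE (x : SS) : idem SS x <->
  forall delta (h : (delta <= tag x)%O), idem (F delta) (ss_down h).
Proof.
split=> [hx delta h|H]; first exact: ss_idemD.
apply: ss_eq => [|delta h h']; first by rewrite /= meetxx.
by rewrite (ss_downD h h' h'); exact: H.
Qed.

(** The premise is the induction hypothesis of [ss_Ann_seriesE] at level [k]; applied to [- x + y],
    it turns the congruence on [SS] into componentwise ones. *)
Lemma ss_simE k (x y : SS) :
  (forall z : SS, Ann_series SS k z <->
     forall delta (h : (delta <= tag z)%O), Ann_series (F delta) k (ss_down h)) ->
  sim (Ann_series SS k) x y <->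
  tag x = tag y /\ forall delta (hx : (delta <= tag x)%O) (hy : (delta <= tag y)%O),
    sim (Ann_series (F delta) k) (ss_down hx) (ss_down hy).
Proof.
move=> IH; rewrite /sim ss_zero_eq IH; split=> [] [e H]; split=> // delta.
  move=> hx hy; split; first exact: skew_brace_zero.
  have h : (delta <= tag (ss_add (ss_opp x) y))%O by rewrite /= lexI hx.
  by have := H _ h; rewrite (ss_downD h (hx : (delta <= tag (ss_opp x))%O) hy) ss_downN.
move=> h; have : (delta <= tag x `&` tag y)%O by [].
rewrite lexI => /andP[hx hy].
rewrite (ss_downD h (hx : (delta <= tag (ss_opp x))%O) hy) ss_downN.
by have [] := H _ hx hy.
Qed.

(** All [delta] below [tag x] must occur, because combining [x] with an element of another component
    moves it down to the meet. *)
Lemma ss_Ann_seriesE k (x : SS) : Ann_series SS k x <->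
  forall delta (h : (delta <= tag x)%O), Ann_series (F delta) k (ss_down h).
Proof.
elim: k x => [|k IH] x; first exact: ss_idemE.
split=> [/Ann_seriesS H delta h|H]; apply/Ann_seriesS.
  (* A test element of [F delta] becomes an element of [SS], and the resulting congruences are read
     off at [delta], where [y] restricts to [b]. *)
  move=> b; pose y : SS := Tagged (fun alpha => F alpha) b.
  have hy : (delta <= tag y)%O by exact: lexx.
  have yE : ss_down hy = b by exact: sys_map_id.
  have hxy : (delta <= tag x `&` tag y)%O by rewrite lexI h hy.
  have hyx : (delta <= tag y `&` tag x)%O by rewrite lexI h hy.
  have [/(ss_simE _ _ IH)[_ h1] /(ss_simE _ _ IH)[_ h2]
        /(ss_simE _ _ IH)[_ h3]] := H y.
  have {}h1 := h1 delta hxy hyx; have {}h2 := h2 delta hyx hxy.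
  have {}h3 := h3 delta hxy hyx.
  rewrite (ss_downD hxy h hy) (ss_downD hyx hy h) yE in h1.
  rewrite (ss_downD hyx hy h) (ss_downM hxy h hy) yE in h2.
  by rewrite (ss_downM hxy h hy) (ss_downM hyx hy h) yE in h3.
move=> y.
have split_le delta : (delta <= tag x `&` tag y)%O ->
    (delta <= tag x)%O /\ (delta <= tag y)%O.
  by rewrite lexI => /andP.
split; apply/(ss_simE _ _ IH); split=> [|delta h h']; rewrite /= 1?meetC //.
(* Conversely, below the meet both elements restrict to [F delta], where the hypothesis on [x]
   applies to the restriction of [y]. *)
- have [hx hy] := split_le _ h.
  rewrite (ss_downD h hx hy) (ss_downD h' hy hx).
  by have /Ann_seriesS/(_ (ss_down hy))[] := H _ hx.
- have [hx hy] := split_le _ h'.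
  rewrite (ss_downD h hy hx) (ss_downM h' hx hy).
  by have /Ann_seriesS/(_ (ss_down hy))[] := H _ hx.
- have [hx hy] := split_le _ h.
  rewrite (ss_downM h hx hy) (ss_downM h' hy hx).
  by have /Ann_seriesS/(_ (ss_down hy))[] := H _ hx.
Qed.

Lemma ss_Ann_series_setT n : Ann_series SS n = setT :> set SS <->
  forall alpha, Ann_series (F alpha) n = setT :> set (F alpha).
Proof.
split=> [h alpha|h]; apply/seteqP; split=> // a _; last first.
  by apply/ss_Ann_seriesE => delta ha; rewrite h.
pose x : SS := Tagged (fun alpha => F alpha) a.
have hx : (alpha <= tag x)%O by exact: lexx.
have : Ann_series SS n x by rewrite h.
by move=> /ss_Ann_seriesE/(_ alpha hx); rewrite /ss_down sys_map_id.
Qed.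

End StrongSemilatticeAnn.

Theorem proposition6p12 (d : Order.disp_t) (Y : meetSemilatticeType d)
    (F : skew_brace_system Y) :
  (forall n : nat, ann_nilpotent_of_index (strong_semilattice F) n ->
     forall alpha : Y, exists m : nat,
       (m <= n)%N /\ ann_nilpotent_of_index (F alpha) m) /\
  (forall k : Y -> nat,
     (forall alpha : Y, ann_nilpotent_of_index (F alpha) (k alpha)) ->
     forall m : nat,
       (exists alpha : Y, k alpha = m) /\ (forall alpha : Y, (k alpha <= m)%N) ->
       ann_nilpotent_of_index (strong_semilattice F) m).
Proof.
split=> [n /ann_nilpotent_of_indexE[h _] alpha|k hk m [[alpha <-] le]].
  by apply: ann_nilpotent_index; exact: (proj1 (ss_Ann_series_setT F n) h).
apply/ann_nilpotent_of_indexE; split.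
  apply/ss_Ann_series_setT => beta.
  have /ann_nilpotent_of_indexE[h _] := hk beta.
  exact: Ann_series_setT_leq (le beta) h.
(* Minimality is inherited from the component [alpha] where the maximum is attained. *)
move=> n /ss_Ann_series_setT /(_ alpha).
by have /ann_nilpotent_of_indexE[_] := hk alpha; apply.
Qed.
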